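(* Let $\alpha\in(0,1)$ and let $\mathcal M\subseteq\mathcal M_0$. Let $l\colon\mathcal M\to\mathbb R$ be an identifiable functional with a strict $\mathcal M$-identification function $V_l\colon\mathbb R\times\mathbb R\to\mathbb R$. Let $\mathcal M_l=\{F\in\mathcal M:F(l(F)-)\le1-\alpha\}$. Let $b\colon\mathcal M_l\to[0,\infty)$ be defined by $b(F)=\big(\Gamma_\alpha(F)(l(F))-l(F)\big)/2$ (half the length of the shortest $\alpha$-prediction interval with lower endpoint $l(F)$; assumed finite for all $F\in\mathcal M_l$), and set $T_l=(l,b)^\top\colon\mathcal M_l\to\mathbb R\times[0,\infty)$. Then: (i) $T_l$ is identifiable on $\mathcal M_l\cap\mathcal M_{\mathrm{inc,cont}}$ with strict identification function $V\colon\mathbb R\times[0,\infty)\times\mathbb R\to\mathbb R^2$, $$V(z_1,z_2,y)=\big(V_l(z_1,y),\ \mathbf 1\{y\in[z_1,z_1+2z_2]\}-\alpha\big)^\top.$$ (ii) Assume that $\mathcal M_l$ is such that (a) $\mathcal M_l\cap\mathcal M_{\mathrm{inc,cont}}$ is convex; (b) for any $z\in\mathbb R\times(0,\infty)$ there are $F_1,F_2,F_3\in\mathcal M_l\cap\mathcal M_{\mathrm{inc,cont}}$ such that $0$ is in the interior of the convex hull of $\{\bar V(z,F_i):i\in\{1,2,3\}\}\subset\mathbb R^2$; (c) $\bar V(\cdot,F)$ is continuously differentiable on $\mathbb R\times(0,\infty)$ for all $F\in\mathcal M_l\cap\mathcal M_{\mathrm{inc,cont}}$; (d) for any $(l^*,b^*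 )^\top\in\mathbb R\times(0,\infty)$ there are $F_i\in\mathcal M_l\cap\mathcal M_{\mathrm{inc,cont}}$ with densities $f_i$, $i\in\{1,2,3,4\}$, such that $(l(F_i),b(F_i))^\top=(l^*,b^* )^\top$ for $i=1,2,3,4$; $\bar V_l'(l^*,F_1)=\bar V_l'(l^*,F_2)=\bar V_l'(l^*,F_3)$; $f_1(l^*+2b^* )=f_2(l^*+2b^* )$; $f_1(l^*+2b^* )\ne f_3(l^*+2b^* )$; $f_1(l^* )\ne f_2(l^* )$; and $\bar V_l'(l^*,F_4)\ne0$. Then there is no strictly $\mathcal M_l\cap\mathcal M_{\mathrm{inc,cont}}$-consistent scoring function $S$ for $T_l$ such that $\bar S(\cdot,F)$ is twice continuously differentiable on $\mathbb R\times(0,\infty)$ for every $F\in\mathcal M_l\cap\mathcal M_{\mathrm{inc,cont}}$.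
   Context: $\mathcal M_0$ is the class of Borel probability distributions on $\mathbb R$ (identified with their distribution functions); $\mathcal M_{\mathrm{inc,cont}}$ is the subclass of continuous distribution functions that are strictly increasing on $\mathbb R$. $F(a-)=F((-\infty,a))$. For $a$ with $F(a-)\le1-\alpha$, $\Gamma_\alpha(F)(a)=\inf\{c\ge a:F([a,c])\ge\alpha\}\in(-\infty,\infty]$. For a function $V$, $\bar V(x,F)=\int V(x,y)\,dF(y)$ (assumed to exist and be finite); $\bar V_l'(x,F)$ is the derivative of $\bar V_l(\cdot,F)$ at $x$. $V$ is a strict $\mathcal M'$-identification function for a functional $T\colon\mathcal M'\to\mathsf A$ if for all $x\in\mathsf A$, $F\in\mathcal M'$: $\bar V(x,F)=0$ iff $x=T(F)$; $T$ is identifiable if such a $V$ exists. A scoring function for $T_l$ is a map $S\colon(\mathbb R\times[0,\infty))\times\mathbb R\to(-\infty,\infty]$ with $\bar S(x,F)=\int S(x,y)\,dF(y)$ existing and $\bar S(x,F)<\infty$ for all $x$ and all $F$ in the class considered; it is strictly $\mathcal M'$-consistent for $T$ if $\bar S(T(F),F)\le\bar S(x,F)$ for all $x$ and $F\in\mathcal M'$, with equality only if $x=T(F)$. *)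

(* Defs.v *)
From HB Require Import structures.
From mathcomp Require Import all_boot all_order all_algebra.
From mathcomp Require Import all_classical all_reals all_analysis measurable_realfun.

Set Implicit Arguments.
Unset Strict Implicit.
Unset Printing Implicit Defensive.

Import Order.TTheory GRing.Theory Num.Theory.
Import numFieldNormedType.Exports.

Local Open Scope classical_set_scope.
Local Open Scope ring_scope.

Section Distributions.
Context {R : realType}.

Definition distr : Type := probability (measurableTypeR R) R.

Definition distr_fun (F : distr) (x : R) : R := fine (F `]-oo, x]%classic).

Definition inc_cont : set distr :=
  [set F | continuous (distr_fun F) /\ {homo distr_fun F : x y / x < y}].

(** The set function underlying a [probability] is unspecified outside the
    sigma-algebra, so a mixture is determined on measurable sets only. *)
Definition convex_class (M : set distr) : Prop :=
  forall F G : distr, M F -> M G -> forall t : R, 0 <= t <= 1 ->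
  exists2 H : distr, M H &
    forall A, measurable A ->
      (H A = t%:E * F A + (1 - t)%:E * G A)%E.

(** Densities with respect to Lebesgue measure. Continuity is required so that
    the values [f x] at single points depend on [F] only. *)
Definition continuous_density (F : distr) (f : R -> R) : Prop :=
  [/\ continuous f, (forall x, 0 <= f x) &
      forall A, measurable A ->
        F A = (\int[lebesgue_measure]_(x in A) (f x)%:E)%E].

(** [Gamma alpha F a] is [+oo] when no [c] qualifies, as [ereal_inf set0 = +oo]. *)
Definition Gamma (alpha : R) (F : distr) (a : R) : \bar R :=
  ereal_inf [set c%:E | c in
    [set c : R | a <= c /\ (alpha%:E <= F `[a, c]%classic)%E]].

Definition admissible (alpha : R) (M : set distr) (l : distr -> R) : set distr :=
  [set F | M F /\ (F `]-oo, (l F)[%classic <= (1 - alpha)%:E)%E].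

Definition half_length (alpha : R) (l : distr -> R) (F : distr) : R :=
  (fine (Gamma alpha F (l F)) - l F) / 2.

Definition T_l (alpha : R) (l : distr -> R) (F : distr) : R * R :=
  (l F, half_length alpha l F).

End Distributions.
Arguments distr : clear implicits.

(** A functional on a class [M] is a total function on [distr R] of which only
    the values on [M] matter; likewise the functions [V x y] and [S x y] below
    are only ever constrained for [x] in the action domain [A]. *)

Section Identification.
Context {R : realType} {X : Type}.

Definition expect (V : X -> R -> R) (x : X) (F : distr R) : R :=
  (\int[F]_y V x y)%R.

Definition expect2 (V : X -> R -> R * R) (x : X) (F : distr R) : R * R :=
  (expect (fun x y => (V x y).1) x F, expect (fun x y => (V x y).2) x F).

Definition has_expect (V : X -> R -> R) (x : X) (F : distr R) : Prop :=
  F.-integrable [set: measurableTypeR R] (EFin \o V x).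

Definition strict_identification (M : set (distr R)) (A : set X)
    (T : distr R -> X) (V : X -> R -> R) : Prop :=
  forall x F, A x -> M F ->
    has_expect V x F /\ (expect V x F = 0 <-> x = T F).

Definition strict_identification2 (M : set (distr R)) (A : set X)
    (T : distr R -> X) (V : X -> R -> R * R) : Prop :=
  forall x F, A x -> M F ->
    [/\ has_expect (fun x y => (V x y).1) x F,
        has_expect (fun x y => (V x y).2) x F &
        expect2 V x F = (0, 0) <-> x = T F].

End Identification.

Section Scoring.
Context {R : realType} {X : Type}.

Definition score (S : X -> R -> \bar R) (x : X) (F : distr R) : \bar R :=
  (\int[F]_y S x y)%E.

(** Existence of the integral in [[-oo, +oo]]: [\int] is total, with a
    conventional value when both parts have infinite integral. *)
Definition has_score (S : X -> R -> \bar R) (x : X) (F : distr R) : Prop :=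
  measurable_fun [set: R] (S x) /\
  ((\int[F]_y ((S x)^\+ y) < +oo)%E \/ (\int[F]_y ((S x)^\- y) < +oo)%E).

Definition scoring_function (M : set (distr R)) (A : set X)
    (S : X -> R -> \bar R) : Prop :=
  (forall x y, A x -> S x y != -oo%E) /\
  (forall x F, A x -> M F -> has_score S x F /\ (score S x F < +oo)%E).

Definition strictly_consistent (M : set (distr R)) (A : set X)
    (T : distr R -> X) (S : X -> R -> \bar R) : Prop :=
  forall x F, A x -> M F ->
    (score S (T F) F <= score S x F)%E /\
    (score S (T F) F = score S x F -> x = T F).

End Scoring.

(** In finite dimension, continuity of the differential on an open set amounts
    to continuity of every directional derivative. *)
Definition C1_on {R : realType} {V W : normedModType R} (U : set V)
    (f : V -> W) : Prop :=
  forall x, U x ->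
    differentiable f x /\ forall v, {for x, continuous ('D_v f)}.

Definition C2_on {R : realType} {V W : normedModType R} (U : set V)
    (f : V -> W) : Prop :=
  C1_on U f /\ forall v, C1_on U ('D_v f).

Definition conv_hull {R : realType} {W : lmodType R} (A : set W) : set W :=
  [set p | exists n (w : 'I_n -> R) (q : 'I_n -> W),
    [/\ forall i, 0 <= w i /\ A (q i), \sum_i w i = 1 &
        p = \sum_i w i *: q i]].

Definition half_plane {R : realType} : set (R * R) := [set z | 0 <= z.2].

Definition open_half_plane {R : realType} : set (R * R) := [set z | 0 < z.2].

Definition V_interval {R : realType} (alpha : R) (Vl : R -> R -> R)
    (z : R * R) (y : R) : R * R :=
  (Vl z.1 y, \1_(`[z.1, z.1 + 2 * z.2]%classic) y - alpha).

(* Main.v *)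
Require Import Defs.
From HB Require Import structures.
From mathcomp Require Import all_boot all_order all_algebra.
From mathcomp Require Import all_classical all_reals all_analysis measurable_realfun.
From mathcomp Require Import ring lra.

Set Implicit Arguments.
Unset Strict Implicit.
Unset Printing Implicit Defensive.

Import Order.TTheory GRing.Theory Num.Theory.
Import numFieldNormedType.Exports.

Local Open Scope classical_set_scope.
Local Open Scope ring_scope.

(** (i) A continuous strictly increasing [F] charges [[z1, z1 + 2 z2]] with
    [F(z1 + 2 z2) - F(z1)], which equals [alpha] for exactly one [z2 >= 0], and
    the infimum defining [Gamma] is attained there.

    (ii) Osband's principle: at fixed [z] both the expected identification
    function and the expected score gradient are affine in [F], and the second
    vanishes with the first because [T F] is an interior minimiser; as 0 is
    interior to the hull of the moments, the gradient is a linear function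
    [h(z)] of them.  Differentiating this relation at [z = T F] expresses the
    Hessian through [h(z)] and the derivatives of the moments, that is through
    [Vl'], [f(l)] and [f(l + 2b)].  Symmetry of the Hessian, tested on the four
    distributions of (d), kills the entries of [h] governing the derivative in
    the second variable.  The expected score is then constant in [b], which
    contradicts strictness. *)

(** * Mixtures *)

Definition mixture {R : realType} (t : R) (F G H : distr R) : Prop :=
  forall A, measurable A -> (H A = t%:E * F A + (1 - t)%:E * G A)%E.

(** An integral sees only the values of a measure on measurable sets. So [H] may be replaced by the
    sum of the two scaled measures, in which the integral is additive. *)
Lemma ge0_integral_mixture {R : realType} (t : R) (F G H : distr R)
    (f : R -> \bar R) : 0 <= t <= 1 -> mixture t F G H ->
  measurable_fun [set: measurableTypeR R] f -> (forall y, 0 <= f y)%E ->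
  (\int[H]_y f y = t%:E * \int[F]_y f y + (1 - t)%:E * \int[G]_y f y)%E.
Proof.
move=> /andP[t0 t1] HE mf f0; have t1' : 0 <= 1 - t by rewrite subr_ge0.
rewrite (eq_measure_integral
  (measure_add (mscale (NngNum t0) F) (mscale (NngNum t1') G))); last first.
  by move=> A mA _; rewrite [RHS]measure_addE; exact: HE.
by rewrite ge0_integral_measure_add// !ge0_integral_mscale.
Qed.

(** Integrability makes the positive and negative parts finite under [F] and [G], so they recombine
    by real algebra with no indeterminate difference. *)
Lemma integral_mixture {R : realType} (t : R) (F G H : distr R)
    (f : R -> \bar R) : 0 <= t <= 1 -> mixture t F G H ->
  F.-integrable [set: measurableTypeR R] f ->
  G.-integrable [set: measurableTypeR R] f ->
  (\int[H]_y f y = t%:E * \int[F]_y f y + (1 - t)%:E * \int[G]_y f y)%E.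
Proof.
move=> t01 HE iF iG; have mf := measurable_int F iF.
rewrite (integralE F) (integralE G) (integralE H).
rewrite !(ge0_integral_mixture t01 HE)//; last 2 first.
  exact: measurable_funeneg.
  exact: measurable_funepos.
have := integrable_pos_fin_num measurableT iF.
have := integrable_neg_fin_num measurableT iF.
have := integrable_pos_fin_num measurableT iG.
have := integrable_neg_fin_num measurableT iG.
do 4 move=> /fineK <-.
by rewrite -?(EFinN, EFinM, EFinD); congr EFin; ring.
Qed.

Lemma expect_mixture {R : realType} {X : Type} (t : R) (F G H : distr R)
    (V : X -> R -> R) (x : X) : 0 <= t <= 1 -> mixture t F G H ->
  has_expect V x F -> has_expect V x G ->
  expect V x H = t * expect V x F + (1 - t) * expect V x G.
Proof.
move=> t01 HE iF iG; rewrite /expect /Rintegral (integral_mixture t01 HE)//.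
rewrite -[X in (_ * X + _)%E]fineK ?integrable_fin_num//.
by rewrite -[X in (_ + _ * X)%E]fineK ?integrable_fin_num.
Qed.

Lemma score_integrable {R : realType} {X : Type} (S : X -> R -> \bar R) (x : X)
    (F : distr R) : has_score S x F -> score S x F \is a fin_num ->
  F.-integrable [set: measurableTypeR R] (S x).
Proof.
rewrite /score integralE => -[mS fin] h.
have p0 : (0 <= \int[F]_y (S x)^\+ y)%E by exact: integral_ge0.
have n0 : (0 <= \int[F]_y (S x)^\- y)%E by exact: integral_ge0.
(* [has_score] bounds only one of the two parts; a finite difference then bounds the other. *)
have [pfin nfin] : (\int[F]_y (S x)^\+ y < +oo)%E /\
    (\int[F]_y (S x)^\- y < +oo)%E.
  move: h p0 n0 fin.
  by case: (integral _ _ _) => [a| |]; case: (integral _ _ _) => [b| |]//=;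
    rewrite ?ltry//; move=> _ _ _ [].
apply/integrableP; split => //.
rewrite (_ : (fun y => `|S x y|%E) = (S x)^\+ \+ (S x)^\-)%E; last exact: fune_abse.
rewrite ge0_integralD//; last 2 first.
  exact: measurable_funepos.
  exact: measurable_funeneg.
by rewrite lte_add_pinfty.
Qed.

Lemma score_mixture {R : realType} {X : Type} (t : R) (F G H : distr R)
    (S : X -> R -> \bar R) (x : X) : 0 <= t <= 1 -> mixture t F G H ->
  has_score S x F -> score S x F \is a fin_num ->
  has_score S x G -> score S x G \is a fin_num ->
  fine (score S x H) = t * fine (score S x F) + (1 - t) * fine (score S x G).
Proof.
move=> t01 HE hF fF hG fG; rewrite /score (integral_mixture t01 HE).
- by rewrite -/(score S x F) -/(score S x G) -(fineK fF) -(fineK fG).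
- exact: score_integrable.
- exact: score_integrable.
Qed.

(** * The identification function *)

Section PredictionInterval.
Context {R : realType}.
Implicit Types (F : distr R) (x y a c alpha : R).

Lemma distr_fun_oc F x y : x <= y ->
  F `]x, y]%classic = (distr_fun F y - distr_fun F x)%:E.
Proof.
move=> xy; rewrite EFinB /distr_fun !fineK ?fin_num_measure//.
rewrite (_ : `]-oo, y]%classic = `]-oo, x]%classic `|` `]x, y]%classic); last first.
  by rewrite -itv_bndbnd_setU// bnd_simp.
rewrite measureU//; last first.
  rewrite -subset0 => t /= []; rewrite !in_itv/= => tx /andP[xt _].
  by move: (le_lt_trans tx xt); rewrite ltxx.
by rewrite addeAC subee ?add0e// fin_num_measure.
Qed.

(** The point to settle is that [x] carries no mass: enlarging the interval to []x - d / 2, y]]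
    costs less than any given [e], by continuity at [x]. *)
Lemma inc_cont_cc F x y : inc_cont F -> x <= y ->
  F `[x, y]%classic = (distr_fun F y - distr_fun F x)%:E.
Proof.
move=> [Fc _] xy; apply/eqP; rewrite eq_le; apply/andP; split; last first.
  rewrite -distr_fun_oc//; apply: le_measure; rewrite ?inE//.
  exact: subset_itv_oc_cc.
apply/lee_addgt0Pr => e e0.
have [d /= d0 Hd] : \forall t \near x, `|distr_fun F x - distr_fun F t| < e.
  by move/cvgrPdist_lt : (Fc x); exact.
have xd : x - d / 2 < x by rewrite ltrBlDr ltrDl divr_gt0.
have h : `|distr_fun F x - distr_fun F (x - d / 2)| < e.
  apply: Hd; rewrite /= opprB addrC subrK ger0_norm ?divr_ge0 ?(ltW d0)//.
  by rewrite ltr_pdivrMr// ltr_pMr// ltr1n.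
apply: (@le_trans _ _ (F `]x - d / 2, y]%classic)).
  apply: le_measure; rewrite ?inE// => t /=; rewrite !in_itv/= => /andP[xt ->].
  by rewrite (lt_le_trans xd xt).
rewrite distr_fun_oc ?(le_trans (ltW xd))// -EFinD lee_fin.
by have := le_lt_trans (ler_norm _) h; lra.
Qed.

(** Strict monotonicity leaves mass below [alpha] for every endpoint smaller than [c], so the
    infimum is attained at [c]. *)
Lemma Gamma_level alpha F a c : inc_cont F -> a <= c ->
  distr_fun F c - distr_fun F a = alpha -> Gamma alpha F a = c%:E.
Proof.
move=> icF ac aE; have [_ Fi] := icF.
apply/eqP; rewrite eq_le; apply/andP; split.
  by apply: ereal_inf_lbound; exists c => //; split; rewrite // inc_cont_cc// aE.
apply: le_ereal_inf_tmp => _ [c' [ac' + <-]].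
rewrite inc_cont_cc// -aE !lee_fin lerD2r !leNgt.
by apply: contra => /Fi.
Qed.

(** A finite infimum yields some [c1] with mass at least [alpha]; the intermediate value theorem on
    [[a, c1]] then hits [alpha] exactly. *)
Lemma Gamma_finite_level alpha F a : 0 < alpha -> inc_cont F ->
  (Gamma alpha F a < +oo)%E ->
  exists2 c, a <= c & distr_fun F c - distr_fun F a = alpha.
Proof.
move=> a0 icF /ereal_inf_lt[_ [c1 [ac1 + <-]] _].
rewrite inc_cont_cc// lee_fin => h; have [Fc _] := icF.
have [||c] := @IVT _ (distr_fun F) a c1 (distr_fun F a + alpha) ac1.
- by apply: continuous_subspaceT.
- by rewrite ge_min le_max; apply/andP; split; apply/orP; [left|right]; lra.
- rewrite in_itv/= => /andP[ac _] cE; exists c => //; rewrite cE; ring.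
Qed.

Lemma V_interval2_integrable alpha (Vl : R -> R -> R) (z : R * R) F :
  has_expect (fun z y => (V_interval alpha Vl z y).2) z F.
Proof.
rewrite /has_expect /=.
rewrite (_ : _ \o _ = fun y =>
    (\1_(`[z.1, z.1 + 2 * z.2]%classic) y)%:E - alpha%:E)%E; last first.
  by apply/funext => y /=; rewrite EFinB.
apply: integrableB => //.
  exact: integrable_indic.
exact: finite_measure_integrable_cst.
Qed.

Lemma expect_V_interval2 alpha (Vl : R -> R -> R) (z : R * R) F :
  expect (fun z y => (V_interval alpha Vl z y).2) z F =
  fine (F `[z.1, z.1 + 2 * z.2]%classic) - alpha.
Proof.
rewrite /expect /= RintegralB//; last 2 first.
  exact: integrable_indic.
  exact: finite_measure_integrable_cst.
rewrite Rintegral_cst//= probability_setT mulr1; congr (_ - _).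
by rewrite /Rintegral integral_indic ?setIT.
Qed.

Lemma expect_V_interval2_inc_cont alpha (Vl : R -> R -> R) (z : R * R) F :
  inc_cont F -> 0 <= z.2 ->
  expect (fun z y => (V_interval alpha Vl z y).2) z F =
  distr_fun F (z.1 + 2 * z.2) - distr_fun F z.1 - alpha.
Proof.
by move=> icF z0; rewrite expect_V_interval2 inc_cont_cc// lerDl mulr_ge0.
Qed.

Lemma V_interval_identification alpha (M : set (distr R)) (l : distr R -> R)
    (Vl : R -> R -> R) : 0 < alpha -> strict_identification M [set: R] l Vl ->
  (forall F, admissible alpha M l F -> (Gamma alpha F (l F) < +oo)%E) ->
  strict_identification2 (admissible alpha M l `&` inc_cont) half_plane
    (T_l alpha l) (V_interval alpha Vl).
Proof.
move=> a0 Vlid Gfin z F z0 [aF icF]; have [MF _] := aF.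
have [Vli VlE] := Vlid z.1 F I MF.
split; [exact: Vli|exact: V_interval2_integrable|].
have [c lc cE] := Gamma_finite_level a0 icF (Gfin F aF).
have bE : half_length alpha l F = (c - l F) / 2.
  by rewrite /half_length (Gamma_level icF lc cE).
rewrite /expect2 expect_V_interval2_inc_cont// /T_l bE.
split=> [[/VlE z1E z2E]|zE].
  rewrite -z1E in cE lc *; rewrite [LHS]surjective_pairing; congr (_, _).
  (* The first moment has fixed [z.1 = l F]; the second puts the right endpoint at the same level as
     [c], and [distr_fun F] is injective. *)
  have E : distr_fun F (z.1 + 2 * z.2) = distr_fun F c by lra.
  suff : z.1 + 2 * z.2 = c by move=> <-; field.
  have [_ Fi] := icF.
  by case: (ltgtP (z.1 + 2 * z.2) c) => // /Fi; rewrite E ltxx.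
congr (_, _); first by apply/VlE; rewrite zE.
by rewrite zE /= (_ : l F + _ = c) ?cE ?subrr//; field.
Qed.

End PredictionInterval.

(** * Convex sets *)

Section Convexity.
Context {R : realType}.

Definition convex_subset {W : lmodType R} (A : set W) : Prop :=
  forall p q t, A p -> A q -> 0 <= t <= 1 -> A (t *: p + (1 - t) *: q).

(** Convexity with unnormalised weights, which allows induction on finite sums. If [a + b = 0], both
    weights vanish and any point of [A] serves. *)
Lemma convex_subset_add {W : lmodType R} (A : set W) (a b : R) (p q : W) :
  convex_subset A -> A p -> A q -> 0 <= a -> 0 <= b ->
  exists2 r, A r & a *: p + b *: q = (a + b) *: r.
Proof.
move=> cA Ap Aq a0 b0; have [ab0|ab0] := eqVneq (a + b) 0.
  exists p => //; have [-> ->] : a = 0 /\ b = 0 by split; lra.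
  by rewrite addr0 !scale0r addr0.
have ab : 0 < a + b by rewrite lt0r ab0 addr_ge0.
exists ((a / (a + b)) *: p + (1 - a / (a + b)) *: q).
  apply: cA => //; rewrite divr_ge0 ?(ltW ab)//=.
  by rewrite ler_pdivrMr// mul1r lerDl.
by rewrite scalerDr !scalerA; congr (_ *: _ + _ *: _); field.
Qed.

Lemma conv_hull_min {W : lmodType R} (A B : set W) :
  convex_subset A -> B `<=` A -> conv_hull B `<=` A.
Proof.
move=> cA BA p [n [w [q [wq w1 ->]]]].
have {}wq i : 0 <= w i /\ A (q i) by have [? /BA] := wq i.
suff [r Ar ->] : exists2 r, A r & \sum_i w i *: q i = (\sum_i w i) *: r.
  by rewrite w1 scale1r.
(* The normalisation of the weights is given up for the induction, so the empty sum occurs and needs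
   some point of [A]. *)
have [p0 Ap0] : exists p0, A p0.
  case: n w q wq w1 => [|n] w q wq; last by exists (q ord0); have [] := wq ord0.
  by rewrite big_ord0 => /eqP; rewrite eq_sym oner_eq0.
elim: n w q wq {w1} => [|n IH] w q wq.
  by exists p0; rewrite // !big_ord0 scale0r.
have [r Ar Er] := IH (fun i => w (lift ord0 i)) (fun i => q (lift ord0 i))
  (fun i => wq (lift ord0 i)).
have [w0 A0] := wq ord0.
have w'0 : 0 <= \sum_(i < n) w (lift ord0 i).
  by apply: sumr_ge0 => i _; have [] := wq (lift ord0 i).
have [r' Ar' Er'] := convex_subset_add cA A0 Ar w0 w'0.
by exists r'; rewrite // !big_ord_recl Er.
Qed.

(** The convex core of Osband's principle: [A] will consist of triples of two moments and a score
    derivative. Convexity, points over every direction and a trivial fibre over 0 leave room only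
    for a linear graph. *)
Lemma convex_graph_linear (A : set ((R * R) * R)) : convex_subset A ->
  (forall v : R * R, exists t g : R, 0 < t /\ A (t *: v, g)) ->
  (forall g, A ((0, 0), g) -> g = 0) ->
  exists h1 h2 : R, forall p, A p -> p.2 = h1 * p.1.1 + h2 * p.1.2.
Proof.
move=> cA sA A0.
(* The cone over [A] is the graph of an additive, positively homogeneous map. *)
pose K (v : R * R) (g : R) := exists2 t : R, 0 < t & A (t *: v, t *: g).
have Kadd v g v' g' : K v g -> K v' g' -> K (v + v') (g + g').
  move=> [t t0 Ap] [s s0 Aq]; have st : 0 < s + t by rewrite addr_gt0.
  have [r Ar E] := convex_subset_add cA Ap Aq (ltW s0) (ltW t0).
  (* Weighting [t *: v] by [s] and [s *: v'] by [t] gives both vectors the common factor [s * t];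
     dividing by [s + t] returns to [A]. *)
  exists (s * t / (s + t)); first by rewrite divr_gt0// mulr_gt0.
  case: v v' r Ar Ap Aq E => [v1 v2] [v1' v2'] [[r1 r2] r3] Ar Ap Aq [E1 E2 E3].
  have stn0 : s + t != 0 by rewrite gt_eqF.
  rewrite (_ : (_, _) = ((r1, r2), r3))//.
  by congr (_, _, _); apply: (mulfI stn0);
    [apply: etrans E1|apply: etrans E2|apply: etrans E3];
    rewrite /GRing.scale/=; field.
have Kscale v g c : 0 < c -> K v g -> K (c *: v) (c *: g).
  move=> c0 [t t0 Ap]; exists (t / c); first by rewrite divr_gt0.
  by rewrite !scalerA divfK ?gt_eqF.
have K0 g : K (0, 0) g -> g = 0.
  move=> [t t0]; rewrite (_ : t *: (0, 0) = (0, 0)); last first.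
    by apply: injective_projections; exact: mulr0.
  by move=> /A0 /eqP; rewrite mulf_eq0 gt_eqF//= => /eqP.
have Ksurj v : exists g, K v g.
  have [t [g [t0 Ap]]] := sA v; exists (t^-1 * g); exists t => //.
  by rewrite /GRing.scale/= mulrA divff ?mul1r// gt_eqF.
(* The values over [v] and [- v] add up to a value over 0. Hence any two values over [v] are
   opposite to the same value over [- v], which gives uniqueness. *)
have Kopp v g g' : K v g -> K (- v) g' -> g' = - g.
  move=> Kg /(Kadd _ _ _ _ Kg); rewrite subrr => /K0 /eqP.
  by rewrite addrC addr_eq0 => /eqP.
have Kuniq v g g' : K v g -> K v g' -> g = g'.
  have [h Kh] := Ksurj (- v).
  by move=> /Kopp/(_ Kh) hE /Kopp/(_ Kh); rewrite hE => /oppr_inj.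
have Kline e h a : K e h -> K (a *: e) (a * h).
  move=> Keh; case: (ltrgt0P a) => [a0|a0|->].
  - exact: Kscale.
  - have [g Kg] := Ksurj (- e); have gE := Kopp _ _ _ Keh Kg.
    rewrite -(opprK a) scaleNr -scalerN mulNr -mulrN -gE.
    by apply: Kscale; rewrite // oppr_gt0.
  - have [g Kg] := Ksurj (0, 0).
    by rewrite mul0r scale0r -(K0 _ Kg).
have [h1 Kh1] := Ksurj (1, 0); have [h2 Kh2] := Ksurj (0, 1).
exists h1, h2 => -[[a b] g] /= Ap.
have Kp : K (a, b) g by exists 1; rewrite // !scale1r.
apply: Kuniq Kp _; have := Kadd _ _ _ _ (Kline _ _ a Kh1) (Kline _ _ b Kh2).
rewrite (mulrC h1) (mulrC h2) (_ : _ + _ = (a, b))//.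
by congr (_, _); rewrite /= /GRing.scale/= !(mulr0, mulr1, addr0, add0r).
Qed.

End Convexity.

(** * Directional derivatives *)

Section Calculus.
Context {R : realType} {V : normedModType R}.
Implicit Types (x v : V).

(** The two difference quotients are the same function, so directional derivatives transfer through
    [L] without a chain rule, even where [g] is only directionally derivable. *)
Lemma quotient_comp_affine (U W : normedModType R) (L : V -> U) (g : U -> W)
    x v k : (forall h : R, L (h *: v + x) = h *: k + L x) ->
  (fun h : R => h^-1 *: (((g \o L) \o shift x) (h *: v) - (g \o L) x)) =
  (fun h : R => h^-1 *: ((g \o shift (L x)) (h *: k) - g (L x))).
Proof. by move=> LE; apply/funext => h /=; rewrite LE. Qed.

Lemma derivable_comp_affine (U W : normedModType R) (L : V -> U) (g : U -> W)
    x v k : (forall h : R, L (h *: v + x) = h *: k + L x) ->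
  derivable g (L x) k -> derivable (g \o L) x v.
Proof. by move=> LE; rewrite /derivable (quotient_comp_affine _ LE). Qed.

Lemma derive_comp_affine (U W : normedModType R) (L : V -> U) (g : U -> W)
    x v k : (forall h : R, L (h *: v + x) = h *: k + L x) ->
  'D_v (g \o L) x = 'D_k g (L x).
Proof. by move=> LE; rewrite /derive (quotient_comp_affine _ LE). Qed.

End Calculus.

(** * Restriction to lines, interior minima and symmetry of second derivatives *)

Section Lines.
Context {R : realType} {V : normedModType R}.
Implicit Types (f g : V -> R) (x u v : V).

Lemma derivable_line (W : normedModType R) (f : V -> W) x u (s : R) :
  derivable f (x + s *: u) u ->
  is_derive s 1 (fun s => f (x + s *: u)) ('D_u f (x + s *: u)).
Proof.
move=> df.
have LE (h : R) : x + (h *: 1 + s) *: u = h *: u + (x + s *: u).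
  by rewrite [h%:A]mulr1 scalerDl addrCA.
apply: DeriveDef; first exact: derivable_comp_affine LE df.
exact: derive_comp_affine LE.
Qed.

Lemma derive_at_interior_min (U : set V) f x v : open U -> U x ->
  (forall y, U y -> derivable f y v) -> (forall y, U y -> f x <= f y) ->
  'D_v f x = 0.
Proof.
move=> oU Ux df minf.
have [e e0 He] : exists2 e : R, 0 < e & forall t, -e < t < e -> U (x + t *: v).
  have : \forall t \near (0 : R), U (x + t *: v).
    have : {for 0, continuous (fun t : R => x + t *: v)}.
      by apply: continuousD; [exact: cst_continuous|exact: scalel_continuous].
    by apply; rewrite scale0r addr0; exact: open_nbhs_nbhs.
  move=> [e /= e0 He]; exists e => // t te; apply: He => /=.
  by rewrite sub0r normrN ltr_norml.
have D t : -e < t < e -> is_derive t 1 (fun t => f (x + t *: v)) ('D_v f (x + t *: v)).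
  by move=> /He Ut; apply: derivable_line; exact: df.
have e0' : -e < 0 < e by rewrite oppr_lt0 e0.
have [] := @derive1_at_min _ (fun t => f (x + t *: v)) (-e) e 0.
- by rewrite ge0_cp// ltW.
- by move=> t; rewrite in_itv/= => /D [].
- by rewrite in_itv.
- by move=> t; rewrite in_itv/= => /He; rewrite scale0r addr0; exact: minf.
have [_] := D 0 e0'; rewrite scale0r addr0 => <- _ //.
Qed.

(** In [osband_derivative] this removes the derivatives of the minors. *)
Lemma derive_mul_at_zero f g x v : derivable f x v -> derivable g x v ->
  f x = 0 -> 'D_v (f * g) x = g x * 'D_v f x.
Proof. by move=> df dg f0; rewrite (deriveM df dg) f0 scale0r; exact: add0r. Qed.

Lemma nbhs_parallelogram (P : set V) x u v : nbhs x P ->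
  exists2 h : R, 0 < h & forall s t, 0 <= s <= h -> 0 <= t <= h ->
    P (x + s *: u + t *: v).
Proof.
move=> /nbhs_ballP[e /= e0 He].
have n0 : 0 < `|u| + `|v| + 1 by rewrite ltr_wpDl// addr_ge0.
(* The summand 1 keeps the denominator positive and the final estimate strict, even if [u] and [v]
   are both 0. *)
exists (e / (`|u| + `|v| + 1)); first by rewrite divr_gt0.
move=> s t /andP[s0 sh] /andP[t0 th]; apply: He; rewrite -ball_normE /=.
rewrite -addrA opprD addNKr normrN (le_lt_trans (ler_normD _ _))// !normrZ.
rewrite !ger0_norm//.
apply: (@le_lt_trans _ _ (e / (`|u| + `|v| + 1) * (`|u| + `|v|))).
  by rewrite mulrDr lerD// ler_wpM2r.
by rewrite mulrAC ltr_pdivrMr// ltr_pM2l// ltrDl.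
Qed.

(** The mean value theorem is applied twice: along [u] to the increment [phi] of [f] in direction
    [v], then along [v] to ['D_u f]. *)
Lemma second_difference (U : set V) f x u v (h : R) : 0 < h -> C2_on U f ->
  (forall s t, 0 <= s <= h -> 0 <= t <= h -> U (x + s *: u + t *: v)) ->
  exists s t, [/\ 0 <= s <= h, 0 <= t <= h &
    f (x + h *: u + h *: v) - f (x + h *: u) - (f (x + h *: v) - f x) =
    h ^+ 2 * 'D_v ('D_u f) (x + s *: u + t *: v)].
Proof.
move=> h0 [C1f C2f] HU.
have hh : 0 <= h <= h by rewrite lexx ltW.
have h00 : (0 : R) <= 0 <= h by rewrite lexx ltW.
have df y w : U y -> derivable f y w by move=> /C1f[/diff_derivable].
have df2 y w w' : U y -> derivable ('D_w f) y w' by move=> /(C2f w)[/diff_derivable].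
pose phi s := f (x + s *: u + h *: v) - f (x + s *: u).
pose dphi s := 'D_u f (x + s *: u + h *: v) - 'D_u f (x + s *: u).
have Dphi s : 0 <= s <= h -> is_derive s 1 phi (dphi s).
  move=> sh; apply: is_deriveB; last first.
    by apply: derivable_line; apply: df; have := HU s 0 sh h00; rewrite scale0r addr0.
  rewrite (_ : (fun s => _) = fun s => f (x + h *: v + s *: u)); last first.
    by apply/funext => r; rewrite addrAC.
  by rewrite addrAC; apply: derivable_line; apply: df; rewrite addrAC; exact: HU.
have [|s sh Es] := MVT_segment (ltW h0) (fun s sh => Dphi s (subset_itv_oo_cc sh)).
  by apply: derivable_within_continuous => s sh; have [] := Dphi s sh.
pose psi t := 'D_u f (x + s *: u + t *: v).
have Dpsi t : 0 <= t <= h ->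
    is_derive t 1 psi ('D_v ('D_u f) (x + s *: u + t *: v)).
  by move=> th; apply: derivable_line; apply: df2; exact: HU.
have [|t th Et] := MVT_segment (ltW h0) (fun t th => Dpsi t (subset_itv_oo_cc th)).
  by apply: derivable_within_continuous => t th; have [] := Dpsi t th.
exists s, t; split => //; move: Es Et.
rewrite /phi /dphi /psi !scale0r !addr0 subr0 => -> ->.
by rewrite expr2 [RHS]mulrC mulrA.
Qed.

(** The second difference is symmetric in [u] and [v], so the two mixed derivatives agree at two
    possibly different points of an arbitrarily small parallelogram. Continuity carries the equality
    to [x]. *)
Lemma schwarz (U : set V) f x u v : open U -> U x -> C2_on U f ->
  'D_v ('D_u f) x = 'D_u ('D_v f) x.
Proof.
have tri (e a b c : R) : `|a - c| <= e / 2 -> `|b - c| <= e / 2 -> `|a - b| <= e.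
  by move=> ac; rewrite distrC => bc; have := ler_distD c a b; lra.
move=> oU Ux C2f; apply/eqP; rewrite -subr_eq0 -normr_le0; apply/ler_addgt0Pl => e e0.
have [_ C2f'] := C2f; have e2 : 0 < e / 2 by rewrite divr_gt0.
have [_ /(_ v)/cvgrPdist_lt/(_ _ e2) cu] := C2f' u _ Ux.
have [_ /(_ u)/cvgrPdist_lt/(_ _ e2) cv] := C2f' v _ Ux.
have nU : nbhs x U by exact: open_nbhs_nbhs.
have [h h0 Hh] := nbhs_parallelogram u v (filterI nU (filterI cu cv)).
have [|s [t [sh th Es]]] := second_difference h0 C2f (u := u) (v := v) (x := x).
  by move=> s t sh th; have [] := Hh s t sh th.
have [|s' [t' [sh' th' Es']]] := second_difference h0 C2f (u := v) (v := u) (x := x).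
  by move=> s' t' sh' th'; rewrite addrAC; have [] := Hh t' s' th' sh'.
have E : 'D_v ('D_u f) (x + s *: u + t *: v) =
         'D_u ('D_v f) (x + s' *: v + t' *: u).
  have cancel (a b : R) : h ^+ 2 * a = h ^+ 2 * b -> a = b.
    exact/mulfI/lt0r_neq0/exprn_gt0.
  have swap (a b c d : R) : a - b - (c - d) = a - c - (b - d) by ring.
  rewrite [x + h *: v + h *: u]addrAC in Es'.
  exact: cancel (etrans (esym Es) (etrans (swap _ _ _ _) Es')).
have [_ [/= /ltW A _]] := Hh s t sh th.
have [_ [_ /=]] := Hh t' s' th' sh'; rewrite addrAC => /ltW B.
rewrite -E in B; rewrite addr0.
exact: tri A B.
Qed.

End Lines.

(** * Differentiating the moments *)

Section Densities.
Context {R : realType}.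
Implicit Types (F : distr R) (f : R -> R).

(** The fundamental theorem of calculus on []-oo, x + 1]], where [f] is integrable because its
    integral is a probability. *)
Lemma distr_fun_is_derive F f (x : R) : continuous_density F f ->
  is_derive x 1 (distr_fun F) (f x).
Proof.
move=> [cf f0 Ff].
have mf : measurable_fun [set: R] f by exact: continuous_measurable_fun.
have x1 : x < x + 1 by rewrite ltrDl.
have int_f : lebesgue_measure.-integrable `]-oo, (x + 1)] (EFin \o f).
  apply/integrableP; split.
    by apply/measurable_EFinP; exact: measurable_funTS.
  under eq_integral do rewrite /= ger0_norm//.
  by rewrite -Ff// ltey_eq fin_num_measure.
have [] := continuous_FTC1 x1 int_f (ltNyr _) (cf x).
rewrite (_ : (fun y => _) = distr_fun F); last first.
  by apply/funext => y; rewrite /distr_fun Ff.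
by rewrite derive1E => dF FE; exact: DeriveDef.
Qed.

Lemma is_derive1_scale (G : R -> R) (x k d : R) :
  is_derive x 1 G d -> is_derive x k G (k * d).
Proof.
move=> [dG GE]; have df := (derivable1_diffP _ _).1 dG.
apply: DeriveDef; first exact: diff_derivable.
by rewrite deriveE// -GE deriveE// -linearZ /= [k%:A]mulr1.
Qed.

Lemma open_open_half_plane : open (@open_half_plane R).
Proof.
rewrite (_ : open_half_plane = snd @^-1` [set t : R | 0 < t])//.
apply: open_comp; last exact: open_gt.
by move=> z _; exact: cvg_snd.
Qed.

Lemma derive_expect_V_interval2 alpha (Vl : R -> R -> R) F f (z v : R * R) :
  inc_cont F -> continuous_density F f -> open_half_plane z ->
  'D_v (fun z => (expect2 (V_interval alpha Vl) z F).2) z =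
  (v.1 + 2 * v.2) * f (z.1 + 2 * z.2) - v.1 * f z.1.
Proof.
move=> icF Ff z0.
pose L (z : R * R) := z.1 + 2 * z.2.
pose G := (distr_fun F \o L) - (distr_fun F \o fst) - cst alpha.
(* The closed form [G] requires [0 <= z.2]; this holds near [z], and a derivative is local. *)
rewrite (near_eq_derive (g := G)); last first.
  have : nbhs z open_half_plane.
    by apply: open_nbhs_nbhs; split => //; exact: open_open_half_plane.
  by apply: filterS => y /ltW y0; rewrite /= expect_V_interval2_inc_cont.
have LE (h : R) : L (h *: v + z) = h *: (v.1 + 2 * v.2) + L z.
  by rewrite /L /= /GRing.scale/=; ring.
have fE (h : R) : (h *: v + z).1 = h *: v.1 + z.1 by [].
have [d1 D1] := is_derive1_scale (v.1 + 2 * v.2) (distr_fun_is_derive (L z) Ff).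
have [d2 D2] := is_derive1_scale v.1 (distr_fun_is_derive z.1 Ff).
have I1 : is_derive z v (distr_fun F \o L) ((v.1 + 2 * v.2) * f (L z)).
  by split; [exact: derivable_comp_affine LE d1|rewrite (derive_comp_affine _ LE)].
have I2 : is_derive z v (distr_fun F \o fst) (v.1 * f z.1).
  split; first exact: (derivable_comp_affine (L := fst) fE d2).
  by rewrite (derive_comp_affine (L := fst) _ fE).
have [_] := is_deriveB (is_deriveB I1 I2) (is_derive_cst alpha z v).
by rewrite subr0.
Qed.

Lemma derive_expect_V_interval1 alpha (Vl : R -> R -> R) F (z v : R * R) :
  'D_v (fun z => (expect2 (V_interval alpha Vl) z F).1) z =
  'D_(v.1) (fun x => expect Vl x F) z.1.
Proof.
have fE (h : R) : (h *: v + z).1 = h *: v.1 + z.1 by [].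
exact: (derive_comp_affine (L := fst) (fun x => expect Vl x F) fE).
Qed.

End Densities.

(** * Osband's principle *)

Section Osband.
Context {R : realType} {I : Type} (P : set I).

Lemma interior0_absorbing (B : set (R * R)) : interior B (0, 0) ->
  forall v : R * R, exists2 t : R, 0 < t & B (t *: v).
Proof.
move=> B0 v; have [h h0 Hh] := nbhs_parallelogram v 0 B0.
exists h => //; have := Hh h 0; rewrite scaler0 addr0 add0r; apply.
  by rewrite lexx ltW.
by rewrite lexx ltW.
Qed.

Section Pointwise.
Variables (a b g : I -> R).
Hypothesis mix : forall F G t, P F -> P G -> 0 <= t <= 1 ->
  exists2 H, P H & [/\ a H = t * a F + (1 - t) * a G,
                       b H = t * b F + (1 - t) * b G &
                       g H = t * g F + (1 - t) * g G].

(** Mixing makes the set of moment vectors convex, so it contains the hull of [B] and hence a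
    neighbourhood of 0. *)
Lemma absorbing_index (B : set (R * R)) :
  B `<=` [set (a F, b F) | F in P] -> interior (conv_hull B) (0, 0) ->
  forall v : R * R, exists F (t : R), [/\ P F, 0 < t & (a F, b F) = t *: v].
Proof.
move=> BP B0 v; have [t t0 Bt] := interior0_absorbing B0 v.
have : [set (a F, b F) | F in P] (t *: v).
  apply: conv_hull_min BP _ Bt => _ _ s [F PF <-] [G PG <-] s01.
  by have [H PH [aH bH _]] := mix PF PG s01; exists H; rewrite ?aH ?bH.
by move=> [F PF FE]; exists F, t.
Qed.

Lemma osband_pointwise (B : set (R * R)) :
  B `<=` [set (a F, b F) | F in P] -> interior (conv_hull B) (0, 0) ->
  (forall F, P F -> a F = 0 -> b F = 0 -> g F = 0) ->
  exists h1 h2, forall F, P F -> g F = h1 * a F + h2 * b F.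
Proof.
move=> BP B0 g0.
have [|v|_ [F PF [aF bF <-]]|h1 [h2 hE]] :=
  @convex_graph_linear R [set ((a F, b F), g F) | F in P].
- move=> _ _ t [F PF <-] [G PG <-] t01.
  have [H PH [aH bH gH]] := mix PF PG t01.
  by exists H => //; rewrite aH bH gH.
- have [F [t [PF t0 FE]]] := absorbing_index BP B0 v.
  by exists t, (g F); split => //; exists F => //; rewrite FE.
- exact: g0.
- by exists h1, h2 => F PF; apply: (hE ((a F, b F), g F)); exists F.
Qed.

End Pointwise.

(* The identity differentiated below is the vanishing of the determinant of the
   vectors [(a, b, g)] at [F], [G], [H]; no regularity of [h1] and [h2] as
   functions of [z] is involved. *)
Lemma osband_derivative (a b g : I -> R * R -> R) (z v : R * R) (F G H : I)
    (h1 h2 : R) :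
  (\forall y \near z, exists k1 k2,
     forall K, P K -> g K y = k1 * a K y + k2 * b K y) ->
  (forall K, P K -> g K z = h1 * a K z + h2 * b K z) ->
  (forall K, P K -> [/\ derivable (a K) z v, derivable (b K) z v &
                        derivable (g K) z v]) ->
  P F -> P G -> P H ->
  a F z != 0 -> b F z = 0 -> a G z = 0 -> b G z != 0 ->
  a H z = 0 -> b H z = 0 ->
  'D_v (g H) z = h1 * 'D_v (a H) z + h2 * 'D_v (b H) z.
Proof.
move=> near_lin linz der PF PG PH aF bF aG bG aH bH.
have [daF dbF dgF] := der F PF; have [daG dbG dgG] := der G PG.
have [daH dbH dgH] := der H PH.
have gH : g H z = 0 by rewrite linz// aH bH !mulr0 addr0.
have gF := linz F PF; have gG := linz G PG.
pose minor (p q r s : R * R -> R) := p * q - r * s.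
have dminor p q r s : derivable p z v -> derivable q z v ->
    derivable r z v -> derivable s z v -> derivable (minor p q r s) z v.
  by move=> dp dq dr ds; exact: derivableB (derivableM dp dq) (derivableM dr ds).
have dk1 := dminor _ _ _ _ daF dbG daG dbF.
have dk2 := dminor _ _ _ _ dgF dbG dgG dbF.
have dk3 := dminor _ _ _ _ daF dgG daG dgF.
have E : 'D_v (g H * minor (a F) (b G) (a G) (b F)) z =
  'D_v (a H * minor (g F) (b G) (g G) (b F) +
        b H * minor (a F) (g G) (a G) (g F)) z.
  apply: near_eq_derive; apply: filterS near_lin => y [k1 [k2 kE]].
  rewrite /minor !fctE (kE F)// (kE G)// (kE H)//; ring.
have E' := deriveD (derivableM daH dk2) (derivableM dbH dk3).
have := etrans (esym (derive_mul_at_zero dgH dk1 gH)) (etrans E E').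
rewrite (derive_mul_at_zero daH dk2 aH) (derive_mul_at_zero dbH dk3 bH).
rewrite /minor !fctE gF gG aG bF !(mulr0, mul0r, addr0, add0r, subr0) => EE.
(* As [b F] and [a G] vanish at [z], the three minors become [p * q] times 1, [h1] and [h2], with
   [p = a F z] and [q = b G z]. *)
have cancel (d d1 d2 p q : R) : p != 0 -> q != 0 ->
    p * q * d = h1 * p * q * d1 + p * (h2 * q) * d2 -> d = h1 * d1 + h2 * d2.
  move=> p0 q0 eq; apply: (mulfI (mulf_neq0 p0 q0)); rewrite eq; ring.
exact: cancel aF bG EE.
Qed.

End Osband.

Lemma derivable_pair {R : realType} (V : normedModType R) (f : V -> R * R) x v :
  derivable f x v ->
  derivable (fun y => (f y).1) x v /\ derivable (fun y => (f y).2) x v.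
Proof.
move=> /cvg_ex[l fl]; split; apply/cvg_ex.
  by exists l.1; exact: cvg_comp fl cvg_fst.
by exists l.2; exact: cvg_comp fl cvg_snd.
Qed.

(** * Gradient and Hessian of the expected score *)

Section Scores.
Context {R : realType} (P : set (distr R)) (T : distr R -> R * R)
  (V : R * R -> R -> R * R) (S : R * R -> R -> \bar R).

Local Notation a := (fun F z => (expect2 V z F).1).
Local Notation b := (fun F z => (expect2 V z F).2).
Local Notation s := (fun F z => fine (score S z F)).
Local Notation g := (fun u F z => 'D_u (s F) z).

Hypothesis Pconv : convex_class P.
Hypothesis Vid : strict_identification2 P half_plane T V.
Hypothesis Vhull : forall z : R * R, open_half_plane z ->
  exists F1 F2 F3 : distr R, [/\ P F1, P F2, P F3 &
    interior (conv_hull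
      [set expect2 V z F1; expect2 V z F2; expect2 V z F3]) (0, 0)].
Hypothesis VC1 : forall F, P F -> C1_on open_half_plane (expect2 V ^~ F).
Hypothesis Sscoring : scoring_function P half_plane S.
Hypothesis Scons : strictly_consistent P half_plane T S.
Hypothesis Sfin : forall F z, P F -> open_half_plane z ->
  score S z F \is a fin_num.
Hypothesis SC2 : forall F, P F -> C2_on open_half_plane (s F).

Let half_planeW z : open_half_plane z -> @half_plane R z.
Proof. exact: ltW. Qed.

Let near_half_plane z : @open_half_plane R z -> \forall y \near z, open_half_plane y.
Proof. by move=> z0; apply: open_nbhs_nbhs; split => //; exact: open_open_half_plane. Qed.

Let s_derivable F z u : P F -> open_half_plane z -> derivable (s F) z u.
Proof. by move=> PF /((SC2 PF).1)[/diff_derivable]. Qed.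

Let moment_mixture u z F G t : open_half_plane z -> P F -> P G -> 0 <= t <= 1 ->
  exists2 H, P H & [/\ a H z = t * a F z + (1 - t) * a G z,
                       b H z = t * b F z + (1 - t) * b G z &
                       g u H z = t * g u F z + (1 - t) * g u G z].
Proof.
move=> z0 PF PG t01; have [H PH HE] := Pconv PF PG t01; exists H => //.
have [aF bF _] := Vid (half_planeW z0) PF.
have [aG bG _] := Vid (half_planeW z0) PG.
split; [exact: expect_mixture aF aG|exact: expect_mixture bF bG|].
(* One mixture [H] works at all points near [z], so the affine relation can be differentiated. *)
have sH : \forall y \near z, s H y = (t *: s F + (1 - t) *: s G) y.
  apply: filterS (near_half_plane z0) => y y0.
  have yh := half_planeW y0.
  by apply: score_mixture HE (Sscoring.2 _ _ yh PF).1 (Sfin PF y0)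
    (Sscoring.2 _ _ yh PG).1 (Sfin PG y0).
have dF := s_derivable (u := u) PF z0; have dG := s_derivable (u := u) PG z0.
rewrite (near_eq_derive _ sH).
rewrite (deriveD (derivableZ (k := t) dF) (derivableZ (k := 1 - t) dG)).
by rewrite !deriveZ.
Qed.

Let hull_index z : open_half_plane z -> exists B : set (R * R),
  B `<=` [set (a F z, b F z) | F in P] /\ interior (conv_hull B) (0, 0).
Proof.
move=> /Vhull[F1 [F2 [F3 [P1 P2 P3 Bint]]]].
exists [set expect2 V z F1; expect2 V z F2; expect2 V z F3]; split => //.
by move=> _ [[|]|] ->; [exists F1|exists F2|exists F3].
Qed.

Let score_gradient_linear u z : open_half_plane z ->
  exists h1 h2, forall F, P F -> g u F z = h1 * a F z + h2 * b F z.
Proof.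
move=> z0; have [B [BP B0]] := hull_index z0.
apply: (osband_pointwise (fun F G t => @moment_mixture u z F G t z0) BP B0).
(* Vanishing moments identify [z] as [T F], where consistency puts a minimum of the expected
   score. *)
move=> F PF aF bF; have zT : z = T F.
  have [_ _ [VT _]] := Vid (half_planeW z0) PF; apply: VT.
  by rewrite [LHS]surjective_pairing aF bF.
apply: (derive_at_interior_min open_open_half_plane z0) => y y0.
  exact: s_derivable.
apply: fine_le; [exact: Sfin|exact: Sfin|].
by rewrite [X in score S X]zT; have [] := Scons (half_planeW y0) PF.
Qed.

(** The coefficients are chosen before [v] and [H], so the conditions obtained from several
    distributions form one linear system. *)
Let score_hessian_linear u z : open_half_plane z ->
  exists h1 h2, (forall F, P F -> g u F z = h1 * a F z + h2 * b F z) /\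
    forall v H, P H -> T H = z ->
      'D_v (g u H) z = h1 * 'D_v (a H) z + h2 * 'D_v (b H) z.
Proof.
move=> z0; have [h1 [h2 hE]] := score_gradient_linear u z0.
exists h1, h2; split => // v H PH TH.
have [B [BP B0]] := hull_index z0.
have span := absorbing_index (fun F G t => @moment_mixture u z F G t z0) BP B0.
(* [F] and [G] have moment vectors on the two axes, so the minor to be cancelled is nonzero at
   [z]. *)
have [F [t [PF t0 [aF bF]]]] := span (1, 0).
have [G [r [PG r0 [aG bG]]]] := span (0, 1).
have [_ _ [_ VT]] := Vid (half_planeW z0) PH.
have [aH bH] := VT (esym TH).
apply: (@osband_derivative _ _ P a b (g u) z v F G H h1 h2) => //.
- apply: filterS (near_half_plane z0) => y y0.
  exact: score_gradient_linear.
- move=> K PK; have [dV _] := VC1 PK z0.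
  have [da db] := derivable_pair (diff_derivable (v := v) dV).
  have [dg _] := (SC2 PK).2 u z z0.
  by split; [exact: da|exact: db|exact: diff_derivable dg].
- exact: etrans (congr1 (fun x => x != 0) (etrans aF (mulr1 t))) (lt0r_neq0 t0).
- exact: etrans bF (mulr0 t).
- exact: etrans aG (mulr0 r).
- exact: etrans (congr1 (fun x => x != 0) (etrans bG (mulr1 r))) (lt0r_neq0 r0).
Qed.

Lemma score_hessian_symmetry u v z : open_half_plane z ->
  exists h1 h2 k1 k2,
    [/\ forall F, P F -> g u F z = h1 * a F z + h2 * b F z,
        forall F, P F -> g v F z = k1 * a F z + k2 * b F z &
        forall H, P H -> T H = z ->
          h1 * 'D_v (a H) z + h2 * 'D_v (b H) z =
          k1 * 'D_u (a H) z + k2 * 'D_u (b H) z].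
Proof.
move=> z0; have [h1 [h2 [hE hD]]] := score_hessian_linear u z0.
have [k1 [k2 [kE kD]]] := score_hessian_linear v z0.
exists h1, h2, k1, k2; split; [exact: hE|exact: kE|move=> H PH TH].
have sym := schwarz u v open_open_half_plane z0 (SC2 PH).
exact: etrans (esym (hD v H PH TH)) (etrans sym (kD u H PH TH)).
Qed.

End Scores.

(* The equations are the symmetry conditions for [F1], ..., [F4] of (d), with
   [x], [w], [w'], [x4] the densities at [l] and [y], [y'], [y4] those at
   [l + 2b]. *)
Lemma linear_system_trivial {R : realType} (h1 h2 k1 k2 d x y y' w w' d4 x4 y4 : R) :
  h1 * 0 + h2 * (2 * y) = k1 * d + k2 * (y - x) ->
  h1 * 0 + h2 * (2 * y) = k1 * d + k2 * (y - w) ->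
  h1 * 0 + h2 * (2 * y') = k1 * d + k2 * (y' - w') ->
  h1 * 0 + h2 * (2 * y4) = k1 * d4 + k2 * (y4 - x4) ->
  x != w -> y != y' -> d4 != 0 -> k1 = 0 /\ k2 = 0.
Proof.
move=> E1 E2 E3 E4 xw yy d0.
(* The first two equations differ only in [x] and [w]. Next, the first and third give [h2 = 0], and
   the fourth gives [k1 = 0]. *)
have k20 : k2 = 0.
  have /eqP : k2 * (x - w) = 0 by lra.
  by rewrite mulf_eq0 subr_eq0 (negPf xw) orbF => /eqP.
rewrite {}k20 in E1 E2 E3 E4 *.
have h20 : h2 = 0.
  have /eqP : h2 * (y - y') = 0 by lra.
  by rewrite mulf_eq0 subr_eq0 (negPf yy) orbF => /eqP.
rewrite {}h20 in E4; split => //.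
have /eqP : k1 * d4 = 0 by lra.
by rewrite mulf_eq0 (negPf d0) orbF => /eqP.
Qed.

Lemma constant_along_line {R : realType} {V : normedModType R} (f : V -> R)
    (x v : V) : (forall t : R, 0 <= t <= 1 -> derivable f (x + t *: v) v) ->
  (forall t : R, 0 <= t <= 1 -> 'D_v f (x + t *: v) = 0) -> f (x + v) = f x.
Proof.
move=> df Df.
have D (t : R) : 0 <= t <= 1 -> is_derive t 1 (fun t => f (x + t *: v)) 0.
  move=> t01; have := derivable_line (df t t01); rewrite Df//; exact.
have [|t _] := MVT_segment ler01 (fun t h => D t (subset_itv_oo_cc h)).
  by apply: derivable_within_continuous => t h; have [] := D t h.
by rewrite scale1r scale0r addr0 mul0r => /eqP; rewrite subr_eq0 => /eqP.
Qed.

Theorem proposition4p10 (R : realType) (alpha : R)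
  (M : set (distr R)) (l : distr R -> R) (Vl : R -> R -> R)
  (alpha01 : 0 < alpha < 1)
  (Vl_ident : strict_identification M [set: R] l Vl)
  (Gamma_fin : forall F, admissible alpha M l F ->
     (Gamma alpha F (l F) < +oo)%E) :
  let M' := admissible alpha M l `&` inc_cont in
  let T := T_l alpha l in
  let b := half_length alpha l in
  let V := V_interval alpha Vl in
  (* (i) *)
  strict_identification2 M' half_plane T V /\
  (* (ii) *)
  ((* (a) *)
   convex_class M' ->
   (* (b) *)
   (forall z : R * R, open_half_plane z ->
      exists F1 F2 F3 : distr R, [/\ M' F1, M' F2, M' F3 &
        interior (conv_hull
          [set expect2 V z F1; expect2 V z F2; expect2 V z F3]) (0, 0)]) ->
   (* (c) *)
   (forall F, M' F -> C1_on open_half_plane (fun z => expect2 V z F)) ->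
   (* (d) *)
   (forall ls bs : R, 0 < bs ->
      exists (F1 F2 F3 F4 : distr R) (f1 f2 f3 f4 : R -> R),
      [/\ [/\ M' F1, M' F2, M' F3 & M' F4],
          [/\ continuous_density F1 f1, continuous_density F2 f2,
              continuous_density F3 f3 & continuous_density F4 f4] &
          [/\ (l F1, b F1) = (ls, bs), (l F2, b F2) = (ls, bs),
              (l F3, b F3) = (ls, bs) & (l F4, b F4) = (ls, bs)]] /\
      let dVl F := derive1 (fun x => expect Vl x F) ls in
      [/\ dVl F1 = dVl F2 /\ dVl F2 = dVl F3,
          f1 (ls + 2 * bs) = f2 (ls + 2 * bs),
          f1 (ls + 2 * bs) != f3 (ls + 2 * bs),
          f1 ls != f2 ls &
          dVl F4 != 0]) ->
   ~ exists S : R * R -> R -> \bar R,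
      [/\ scoring_function M' half_plane S,
          strictly_consistent M' half_plane T S &
          forall F, M' F ->
            (forall z, open_half_plane z -> score S z F \is a fin_num) /\
            C2_on open_half_plane (fun z => fine (score S z F))]).
Proof.
move=> M' T b V; have [a0 _] := andP alpha01.
have Vid : strict_identification2 M' half_plane T V.
  exact: V_interval_identification.
split=> // Mconv Vhull VC1 Hd [S [Sscoring Scons SC]].
have Sfin F z : M' F -> open_half_plane z -> score S z F \is a fin_num.
  by move=> /SC[+ _]; exact.
have SC2 F : M' F -> C2_on open_half_plane (fun z => fine (score S z F)).
  by move=> /SC[].
(* The distributions of (d) at [z] make the coefficients of the derivative in direction [(0, 1)]
   vanish, and these coefficients are shared by all [F]. *)
have D2S F z : M' F -> open_half_plane z ->
    'D_((0, 1) : R * R) (fun z => fine (score S z F)) z = 0.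
  case: z => ls bs MF z0.
  have [F1 [F2 [F3 [F4 [f1 [f2 [f3 [f4]]]]]]]] := Hd ls bs z0.
  move=> [[[M1 M2 M3 M4] [d1 d2 d3 d4] [T1 T2 T3 T4]]].
  move=> [[dV12 dV23] f12r f13r f12l dV4].
  have [h1 [h2 [k1 [k2 [_ kE sym]]]]] := score_hessian_symmetry Mconv Vid Vhull
    VC1 Sscoring Scons Sfin SC2 ((1, 0) : R * R) (0, 1) z0.
  have sym' G f : M' G -> T G = (ls, bs) -> continuous_density G f ->
      h1 * 0 + h2 * (2 * f (ls + 2 * bs)) =
      k1 * derive1 (fun x => expect Vl x G) ls + k2 * (f (ls + 2 * bs) - f ls).
    move=> MG TG Gf; have := sym G MG TG.
    (* The first moment does not depend on [z.2], so its derivative along [(0, 1)] is a derivative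
       in direction 0. *)
    rewrite !derive_expect_V_interval1 /= derive0 -derive1E.
    rewrite !(derive_expect_V_interval2 alpha Vl _ MG.2 Gf z0) /=.
    by rewrite !(mulr0, mulr1, mul0r, mul1r, addr0, add0r, subr0).
  have E1 := sym' _ _ M1 T1 d1; have E2 := sym' _ _ M2 T2 d2.
  have E3 := sym' _ _ M3 T3 d3; have E4 := sym' _ _ M4 T4 d4.
  rewrite -dV23 -dV12 in E3; rewrite -dV12 -f12r in E2.
  have [k10 k20] := linear_system_trivial E1 E2 E3 E4 f12l f13r dV4.
  by rewrite kE// k10 k20 !mul0r addr0.
(* Any target would do; [T F = (0, 1)] is convenient. The score of [F] is constant from [(0, 1)] to
   [(0, 2)], so [(0, 2)] is a second minimiser. *)
have [F [_ [_ [_ [_ [_ [_ [_ [[[MF _ _ _] _ [TF _ _ _]] _]]]]]]]]] := Hd 0 1 ltr01.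
have pos (t : R) : 0 <= t <= 1 -> open_half_plane (((0, 1) : R * R) + t *: (0, 1)).
  move=> /andP[t0 _]; rewrite /open_half_plane /= [t%:A]mulr1.
  by rewrite ltr_pwDl.
have SE := @constant_along_line R _ (fun z => fine (score S z F)) (0, 1) (0, 1)
  (fun t t01 => diff_derivable (((SC2 F MF).1 _ (pos t t01)).1))
  (fun t t01 => D2S F _ MF (pos t t01)).
have TF' : T F = (0, 1) by exact: TF.
have x0 : open_half_plane (((0, 1) : R * R) + (0, 1)).
  by rewrite /open_half_plane /= addr_gt0.
have TS : score S (T F) F = score S (((0, 1) : R * R) + (0, 1)) F.
  by rewrite TF' -(fineK (Sfin F _ MF x0)) SE fineK//; apply: Sfin => //; exact: ltr01.
have := (Scons _ F (ltW x0) MF).2 TS.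
by rewrite TF' => -[_ /eqP]; rewrite -subr_eq0 addrK oner_eq0.
Qed.
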